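(* Let $(B,\beta)$ and $(H,\alpha)$ be monoidal Hom-Hopf algebras over a field $k$, with antipodes $S_B$ and $S_H$. Suppose that $(B,\beta)$ is a left $(H,\alpha)$-Hom-module algebra with action $h\otimes b\mapsto h\cdot b$, that $(H,\alpha)$ is a right $(B,\beta)$-Hom-comodule coalgebra with coaction $\rho(h)=\sum h_{(0)}\otimes h_{(1)}\in H\otimes B$, and that $B\#H=B\otimes H$ (write $a\#h$ for $a\otimes h$), with twisting automorphism $\beta\#\alpha=\beta\otimes\alpha$, is a monoidal Hom-bialgebra with the Hom-smash product $$(a\#h)(b\#k)=\sum a(h_{1}\cdot\beta^{-1}(b))\#\alpha(h_{2})k,\qquad\text{unit }1_B\#1_H,$$ and the Hom-smash coproduct $$\Delta(a\#h)=\sum a_{1}\#\alpha(h_{1(0)})\otimes\beta^{-1}(a_{2})h_{1(1)}\# h_{2},\qquad \varepsilon(a\#h)=\varepsilon_{B}(a)\varepsilon_{H}(h).$$ Define $$S(a\#h)=\sum(1_{B}\#S_{H}(h_{(0)}))\,(S_{B}(\beta^{-2}(a)\beta^{-1}(h_{(1)}))\#1_{H}).$$ Then $(B\#H,\beta\#\alpha)$ is a monoidal Hom-Hopf algebra with antipode $S$.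
   Context: All vector spaces, tensor products and linear maps are over a fixed field $k$; Sweedler notation $\Delta(c)=\sum c_1\otimes c_2$ is used, with iterated indices such as $h_{1(0)}$ meaning $(h_1)_{(0)}$. Monoidal Hom-algebra $(A,\alpha)$: a vector space $A$ with a linear automorphism $\alpha$, a linear multiplication $a\otimes b\mapsto ab$ and an element $1_A$ with $\alpha(a)(bc)=(ab)\alpha(c)$, $a1_A=\alpha(a)=1_Aa$, $\alpha(ab)=\alpha(a)\alpha(b)$, $\alpha(1_A)=1_A$. Monoidal Hom-coalgebra $(C,\gamma)$: a vector space $C$ with a linear automorphism $\gamma$ and linear maps $\Delta:C\to C\otimes C$, $\varepsilon:C\to k$ with $\sum\gamma^{-1}(c_1)\otimes\Delta(c_2)=\sum\Delta(c_1)\otimes\gamma^{-1}(c_2)$, $\sum c_1\varepsilon(c_2)=\sum\varepsilon(c_1)c_2=\gamma^{-1}(c)$, $\Delta(\gamma(c))=\sum\gamma(c_1)\otimes\gamma(c_2)$, $\varepsilon(\gamma(c))=\varepsilon(c)$. Monoidal Hom-bialgebra: $(H,\alpha)$ which is both a monoidal Hom-algebra and a monoidal Hom-coalgebra (same $\alpha$), with $\Delta(gh)=\Delta(g)\Delta(h)$, $\Delta(1)=1\otimes1$, $\varepsilon(gh)=\varepsilon(g)\varepsilon(h)$, $\varepsilon(1)=1$ (componentwise product on $H\otimes H$). Monoidal Hom-Hopf algebra: a monoidal Hom-bialgebra with a linear map $S:H\to H$ (antipode) such that $S\alpha=\alpha S$ and $\sum S(h_1)h_2=\varepsilon(h)1=\sum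 h_1S(h_2)$. Left $(H,\alpha)$-Hom-module $(M,\mu)$: $\mu$ a linear automorphism of $M$ and a linear map $H\otimes M\to M$ with $\alpha(h)\cdot(g\cdot m)=(hg)\cdot\mu(m)$, $1\cdot m=\mu(m)$, $\mu(h\cdot m)=\alpha(h)\cdot\mu(m)$. A left $(H,\alpha)$-Hom-module algebra is a monoidal Hom-algebra $(B,\beta)$ that is a left Hom-module (with automorphism $\beta$) with $h\cdot(ab)=\sum(h_1\cdot a)(h_2\cdot b)$, $h\cdot1_B=\varepsilon(h)1_B$. Right $(C,\gamma)$-Hom-comodule $(M,\mu)$: $\mu$ a linear automorphism of $M$ and a linear map $\rho:M\to M\otimes C$, $\rho(m)=\sum m_{(0)}\otimes m_{(1)}$, with $\sum\mu^{-1}(m_{(0)})\otimes\Delta(m_{(1)})=\sum\rho(m_{(0)})\otimes\gamma^{-1}(m_{(1)})$, $\sum\varepsilon(m_{(1)})m_{(0)}=\mu^{-1}(m)$, $\rho(\mu(m))=\sum\mu(m_{(0)})\otimes\gamma(m_{(1)})$. For a monoidal Hom-bialgebra $(B,\beta)$, a right $(B,\beta)$-Hom-comodule coalgebra is a monoidal Hom-coalgebra $(C,\gamma)$ that is a right $(B,\beta)$-Hom-comodule (with automorphism $\gamma$) with $\sum c_{(0)1}\otimes c_{(0)2}\otimes c_{(1)}=\sum c_{1(0)}\otimes c_{2(0)}\otimes c_{1(1)}c_{2(1)}$ and $\sum\varepsilon(c_{(0)})c_{(1)}=\varepsilon(c)1_B$. *)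

(* Defs.v *)
From HB Require Import structures.
From mathcomp Require Import all_boot all_order all_algebra.
From mathcomp Require Import boolp.

Set Implicit Arguments.
Unset Strict Implicit.
Unset Printing Implicit Defensive.

Import GRing.Theory.
Local Open Scope ring_scope.
Local Open Scope quotient_scope.

(* MathComp has no tensor product of arbitrary (possibly infinite-dimensional) *)
(* vector spaces.  V ⊗ W is built as the quotient of formal finite sums        *)
(* [:: (v1, w1); ...; (vn, wn)], read as v1 ⊗ w1 + ... + vn ⊗ wn, by the least *)
(* congruence for concatenation that makes concatenation commutative and       *)
(* v, w |-> [:: (v, w)] bilinear.                                              *)
Inductive tens_eqv (k : fieldType) (V W : lmodType k) :
    seq (V * W) -> seq (V * W) -> Prop :=
  | TensRefl s : tens_eqv s s
  | TensSym s t : tens_eqv s t -> tens_eqv t s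
  | TensTrans s t u : tens_eqv s t -> tens_eqv t u -> tens_eqv s u
  | TensCat s s' t t' :
      tens_eqv s s' -> tens_eqv t t' -> tens_eqv (s ++ t) (s' ++ t')
  | TensCatC s t : tens_eqv (s ++ t) (t ++ s)
  | TensDl v v' w : tens_eqv [:: (v + v', w)] [:: (v, w); (v', w)]
  | TensDr v w w' : tens_eqv [:: (v, w + w')] [:: (v, w); (v, w')]
  | TensZ a v w : tens_eqv [:: (a *: v, w)] [:: (v, a *: w)]
  | Tens0l w : tens_eqv [:: (0, w)] [::].

Lemma tens_eqv_refl (k : fieldType) (V W : lmodType k) :
  reflexive (fun s t : seq (V * W) => `[< tens_eqv s t >]).
Proof. by move=> s; apply/asboolP; exact: TensRefl. Qed.

Lemma tens_eqv_sym (k : fieldType) (V W : lmodType k) :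
  symmetric (fun s t : seq (V * W) => `[< tens_eqv s t >]).
Proof. by move=> s t; apply/asboolP/asboolP => /TensSym. Qed.

Lemma tens_eqv_trans (k : fieldType) (V W : lmodType k) :
  transitive (fun s t : seq (V * W) => `[< tens_eqv s t >]).
Proof.
move=> s t u /asboolP ts /asboolP su; apply/asboolP; exact: TensTrans ts su.
Qed.

Definition tens_equiv (k : fieldType) (V W : lmodType k) :=
  EquivRel (fun s t : seq (V * W) => `[< tens_eqv s t >])
    (@tens_eqv_refl k V W) (@tens_eqv_sym k V W) (@tens_eqv_trans k V W).

Definition tensor (k : fieldType) (V W : lmodType k) : Type :=
  {eq_quot tens_equiv V W}.

HB.instance Definition _ (k : fieldType) (V W : lmodType k) :=
  Choice.copy (tensor V W) {eq_quot tens_equiv V W}.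

Definition tens_of (k : fieldType) (V W : lmodType k) (s : seq (V * W)) :
  tensor V W := \pi_{eq_quot tens_equiv V W} s.

Definition tens_repr (k : fieldType) (V W : lmodType k) (t : tensor V W) :
  seq (V * W) := repr (t : {eq_quot tens_equiv V W}).

Lemma tens_reprK (k : fieldType) (V W : lmodType k) :
  cancel (@tens_repr k V W) (@tens_of k V W).
Proof. exact: reprK. Qed.

Lemma tens_ofP (k : fieldType) (V W : lmodType k) (s t : seq (V * W)) :
  tens_of s = tens_of t <-> tens_eqv s t.
Proof.
rewrite /tens_of; split; last by move=> st; apply/eqmodP/asboolP.
by move=> /eqmodP /asboolP.
Qed.

Lemma tens_repr_of (k : fieldType) (V W : lmodType k) (s : seq (V * W)) :
  tens_eqv (tens_repr (tens_of s)) s.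
Proof. by apply/tens_ofP; rewrite tens_reprK. Qed.

Definition tens_scale_seq (k : fieldType) (V W : lmodType k) (a : k)
  (s : seq (V * W)) := [seq (a *: p.1, p.2) | p <- s].

Lemma tens_scale_seqP (k : fieldType) (V W : lmodType k) (a : k)
    (s t : seq (V * W)) :
  tens_eqv s t -> tens_eqv (tens_scale_seq a s) (tens_scale_seq a t).
Proof.
elim=> {s t} [s|s t _ |s t u _ st _ tu|s s' t t' _ ss' _ tt'|s t|v v' w|v w w'|b v w|w] /=.
- exact: TensRefl.
- exact: TensSym.
- exact: TensTrans st tu.
- by rewrite /tens_scale_seq !map_cat; exact: TensCat.
- by rewrite /tens_scale_seq !map_cat; exact: TensCatC.
- by rewrite scalerDr; exact: TensDl.
- exact: TensDr.
- by rewrite scalerA mulrC -scalerA; exact: TensZ.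
- by rewrite scaler0; exact: Tens0l.
Qed.

Definition tens_zero (k : fieldType) (V W : lmodType k) : tensor V W :=
  tens_of [::].

Definition tens_add (k : fieldType) (V W : lmodType k) (x y : tensor V W) :=
  tens_of (tens_repr x ++ tens_repr y).

Definition tens_scale (k : fieldType) (V W : lmodType k) (a : k)
  (x : tensor V W) := tens_of (tens_scale_seq a (tens_repr x)).

Definition tens_opp (k : fieldType) (V W : lmodType k) (x : tensor V W) :=
  tens_scale (-1) x.

Lemma tens_add_of (k : fieldType) (V W : lmodType k) (s t : seq (V * W)) :
  tens_add (tens_of s) (tens_of t) = tens_of (s ++ t).
Proof. by apply/tens_ofP; apply: TensCat; exact: tens_repr_of. Qed.

Lemma tens_scale_of (k : fieldType) (V W : lmodType k) a (s : seq (V * W)) :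
  tens_scale a (tens_of s) = tens_of (tens_scale_seq a s).
Proof. by apply/tens_ofP; apply: tens_scale_seqP; exact: tens_repr_of. Qed.

Lemma tens_addA (k : fieldType) (V W : lmodType k) :
  associative (@tens_add k V W).
Proof.
move=> x y z; rewrite -[x]tens_reprK -[y]tens_reprK -[z]tens_reprK.
by rewrite !tens_add_of catA.
Qed.

Lemma tens_addC (k : fieldType) (V W : lmodType k) :
  commutative (@tens_add k V W).
Proof.
move=> x y; rewrite -[x]tens_reprK -[y]tens_reprK !tens_add_of.
by apply/tens_ofP; exact: TensCatC.
Qed.

Lemma tens_add0 (k : fieldType) (V W : lmodType k) :
  left_id (tens_zero V W) (@tens_add k V W).
Proof. by move=> x; rewrite -[x]tens_reprK tens_add_of. Qed.

Lemma tens_scaleDl (k : fieldType) (V W : lmodType k) (x : tensor V W) :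
  {morph (@tens_scale k V W)^~ x : a b / a + b >-> tens_add a b}.
Proof.
move=> a b; rewrite -[x]tens_reprK /= !tens_scale_of tens_add_of.
apply/tens_ofP; elim: (tens_repr x) => [|[v w] s IHs] /=; first exact: TensRefl.
apply: (TensTrans (TensCat (TensRefl [:: ((a + b) *: v, w)]) IHs)).
rewrite scalerDl; apply: (TensTrans (TensCat (TensDl _ _ _) (TensRefl _))) => /=.
apply: (TensCat (TensRefl [:: (a *: v, w)])).
rewrite -[X in tens_eqv _ X]/(tens_scale_seq a s ++ [:: (b *: v, w)] ++ _) [X in tens_eqv _ X]catA.
apply: (TensCat _ (TensRefl _) (s := (b *: v, w) :: tens_scale_seq a s)).
exact: (TensCatC [:: (b *: v, w)]).
Qed.

Lemma tens_scale0 (k : fieldType) (V W : lmodType k) (x : tensor V W) :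
  tens_scale 0 x = tens_zero V W.
Proof.
rewrite -[x]tens_reprK tens_scale_of; apply/tens_ofP.
elim: (tens_repr x) => [|[v w] s IHs] /=; first exact: TensRefl.
rewrite scale0r; exact: TensCat (Tens0l _ w) IHs.
Qed.

Lemma tens_scale1 (k : fieldType) (V W : lmodType k) :
  left_id 1 (@tens_scale k V W).
Proof.
move=> x; rewrite -[x]tens_reprK tens_scale_of; congr tens_of.
by rewrite /tens_scale_seq -[RHS]map_id; apply: eq_map => -[v w] /=;
  rewrite scale1r.
Qed.

Lemma tens_addN (k : fieldType) (V W : lmodType k) :
  left_inverse (tens_zero V W) (@tens_opp k V W) (@tens_add k V W).
Proof.
move=> x; rewrite -[X in tens_add _ X]tens_scale1 /tens_opp.
by rewrite -(tens_scaleDl x) addNr tens_scale0.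
Qed.

HB.instance Definition _ (k : fieldType) (V W : lmodType k) :=
  GRing.isZmodule.Build (tensor V W) (@tens_addA k V W) (@tens_addC k V W)
    (@tens_add0 k V W) (@tens_addN k V W).

Lemma tens_scaleA (k : fieldType) (V W : lmodType k) (a b : k)
    (x : tensor V W) :
  tens_scale a (tens_scale b x) = tens_scale (a * b) x.
Proof.
rewrite -[x]tens_reprK !tens_scale_of /tens_scale_seq -map_comp.
by congr tens_of; apply: eq_map => p /=; rewrite scalerA.
Qed.

Lemma tens_scaleDr (k : fieldType) (V W : lmodType k) :
  right_distributive (@tens_scale k V W) +%R.
Proof.
move=> a x y; rewrite /GRing.add /= -[x]tens_reprK -[y]tens_reprK.
by rewrite tens_add_of !tens_scale_of tens_add_of /tens_scale_seq map_cat.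
Qed.

HB.instance Definition _ (k : fieldType) (V W : lmodType k) :=
  GRing.Zmodule_isLmodule.Build k (tensor V W) (@tens_scaleA k V W)
    (@tens_scale1 k V W) (@tens_scaleDr k V W) (@tens_scaleDl k V W).

Definition tens (k : fieldType) (V W : lmodType k) (v : V) (w : W) :
  tensor V W := tens_of [:: (v, w)].

Notation "V ⊗ W" := (tensor V%type W%type) (at level 40, left associativity) : type_scope.
Notation "v ⊗ w" := (tens v w) (at level 40, left associativity) : ring_scope.

Definition is_bilinear (k : fieldType) (V W U : lmodType k)
  (f : V -> W -> U) : Prop :=
  (forall w, linear (f^~ w)) /\ (forall v, linear (f v)).

(* For a bilinear f this is the value at t of the linear map induced by f on   *)
(* V ⊗ W (tlift_tens, tlift_linear, tlift_uniq).  It is defined for any f,     *)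
(* through a representative of t, so that Sweedler sums can be written without *)
(* carrying bilinearity proofs; only bilinear summands are meaningful.         *)
Definition tlift (k : fieldType) (V W : lmodType k) (U : zmodType)
  (f : V -> W -> U) (t : V ⊗ W) : U := \sum_(p <- tens_repr t) f p.1 p.2.

(* Sweedler notation: the sum of F over t = \sum x ⊗ y.                        *)
Notation "\sw_( x ⊗ y <- t ) F" := (tlift (fun x y => F) t)
  (at level 41, x name, y name, t at level 200, F at level 41,
   format "\sw_( x  ⊗  y  <-  t )  F") : ring_scope.

Lemma tens_bilinear (k : fieldType) (V W : lmodType k) :
  is_bilinear (@tens k V W).
Proof.
have sr a (v : V) (w : W) : a *: (v ⊗ w) = v ⊗ (a *: w).
  by rewrite /GRing.scale /= tens_scale_of; apply/tens_ofP; exact: TensZ.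
have sl a (v : V) (w : W) : a *: (v ⊗ w) = (a *: v) ⊗ w.
  by rewrite /GRing.scale /= tens_scale_of.
split=> [w a v v'|v a w w'] /=.
  rewrite sl /tens /GRing.add /= tens_add_of; apply/tens_ofP; exact: TensDl.
rewrite sr /tens [RHS]/GRing.add /= tens_add_of; apply/tens_ofP; exact: TensDr.
Qed.

Lemma tensE (k : fieldType) (V W : lmodType k) (t : V ⊗ W) :
  t = \sum_(p <- tens_repr t) p.1 ⊗ p.2.
Proof.
rewrite -[LHS]tens_reprK; elim: (tens_repr t) => [|p s IHs]; first by rewrite big_nil.
by rewrite big_cons -IHs /GRing.add /= tens_add_of; case: p.
Qed.

Lemma bilinear0l (k : fieldType) (V W U : lmodType k) (f : V -> W -> U) w :
  is_bilinear f -> f 0 w = 0.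
Proof. by case=> fl _; have := fl w (-1) 0 0; rewrite !scaleN1r !addNr. Qed.

Lemma bilinear0r (k : fieldType) (V W U : lmodType k) (f : V -> W -> U) v :
  is_bilinear f -> f v 0 = 0.
Proof. by case=> _ fr; have := fr v (-1) 0 0; rewrite !scaleN1r !addNr. Qed.

Lemma tens_eqv_sum (k : fieldType) (V W U : lmodType k) (f : V -> W -> U)
    (s t : seq (V * W)) : is_bilinear f -> tens_eqv s t ->
  \sum_(p <- s) f p.1 p.2 = \sum_(p <- t) f p.1 p.2.
Proof.
move=> fP; have f0l w := bilinear0l w fP; have f0r v := bilinear0r v fP.
case: fP => fl fr.
elim=> {s t} [//|s t _ -> //|s t u _ -> _ -> //|s s' t t' _ ss' _ tt'|s t|v v' w|v w w'|b v w|w].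
- by rewrite !big_cat /= ss' tt'.
- by rewrite !big_cat /= addrC.
- by rewrite !big_cons !big_nil !addr0 /=; have := fl w 1 v v'; rewrite /= !scale1r.
- by rewrite !big_cons !big_nil !addr0 /=; have := fr v 1 w w'; rewrite /= !scale1r.
- rewrite !big_seq1 /=; have := fl w b v 0; rewrite /= f0l !addr0 => ->.
  by have := fr v b w 0; rewrite /= f0r !addr0 => ->.
- by rewrite big_seq1 big_nil f0l.
Qed.

Lemma tlift_of (k : fieldType) (V W U : lmodType k) (f : V -> W -> U)
    (s : seq (V * W)) : is_bilinear f ->
  tlift f (tens_of s) = \sum_(p <- s) f p.1 p.2.
Proof. by move=> fP; apply: tens_eqv_sum => //; exact: tens_repr_of. Qed.

Lemma tlift_tens (k : fieldType) (V W U : lmodType k) (f : V -> W -> U) v w :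
  is_bilinear f -> tlift f (v ⊗ w) = f v w.
Proof. by move=> fP; rewrite tlift_of // big_seq1. Qed.

Lemma tlift_linear (k : fieldType) (V W U : lmodType k) (f : V -> W -> U) :
  is_bilinear f -> linear (tlift f).
Proof.
move=> fP a x y; rewrite -[x]tens_reprK -[y]tens_reprK.
rewrite {1}/GRing.scale {1}/GRing.add /= tens_scale_of tens_add_of !tlift_of //.
rewrite big_cat /= big_map scaler_sumr; congr (_ + _); apply: eq_bigr => p _ /=.
by have := fP.1 p.2 a p.1 0; rewrite addr0 /= (bilinear0l _ fP) addr0.
Qed.

Lemma tens_ext (k : fieldType) (V W U : lmodType k) (f g : V ⊗ W -> U) :
  linear f -> linear g -> (forall v w, f (v ⊗ w) = g (v ⊗ w)) -> f =1 g.
Proof.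
move=> fl gl fg t; rewrite -[t]tens_reprK.
have lin0 (h : V ⊗ W -> U) : linear h -> h 0 = 0.
  by move=> hl; have := hl (-1) 0 0; rewrite scaler0 addr0 scaleN1r addNr.
elim: (tens_repr t) => [|p s IHs]; first by rewrite [tens_of _]/(0 : V ⊗ W) !lin0.
have -> : tens_of (p :: s) = 1 *: (p.1 ⊗ p.2) + tens_of s.
  by rewrite scale1r /GRing.add /= tens_add_of; case: (p).
by rewrite fl gl fg IHs.
Qed.

Lemma tlift_uniq (k : fieldType) (V W U : lmodType k) (f : V -> W -> U)
    (g : V ⊗ W -> U) :
  is_bilinear f -> linear g -> (forall v w, g (v ⊗ w) = f v w) -> g =1 tlift f.
Proof.
move=> fP gl gf; apply: tens_ext => // [|v w]; first exact: tlift_linear.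
by rewrite tlift_tens.
Qed.

Record linAut (k : fieldType) (V : lmodType k) := LinAut {
  aut_fun :> V -> V;
  aut_inv : V -> V;
  aut_linear : linear aut_fun;
  aut_funK : cancel aut_fun aut_inv;
  aut_invK : cancel aut_inv aut_fun
}.
Arguments linAut k V%_type.
Arguments LinAut k V%_type.

Lemma aut_inv_linear (k : fieldType) (V : lmodType k) (f : linAut V) :
  linear (aut_inv f).
Proof.
by move=> a x y; rewrite -{1}[x](aut_invK f) -{1}[y](aut_invK f) -aut_linear
  aut_funK.
Qed.

Definition tens_map (k : fieldType) (V V' W W' : lmodType k)
  (f : V -> V') (g : W -> W') (t : V ⊗ W) : V' ⊗ W' :=
  \sw_(v ⊗ w <- t) f v ⊗ g w.

Lemma tens_map_bilinear (k : fieldType) (V V' W W' : lmodType k)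
    (f : V -> V') (g : W -> W') :
  linear f -> linear g -> is_bilinear (fun v w => f v ⊗ g w).
Proof.
move=> fl gl; case: (tens_bilinear V' W') => tl tr.
by split=> [w a v v'|v a w w'] /=; [rewrite fl; exact: tl|rewrite gl; exact: tr].
Qed.

Lemma tens_mapK (k : fieldType) (V V' W W' : lmodType k)
    (f : V -> V') (g : W -> W') (f' : V' -> V) (g' : W' -> W) :
  linear f -> linear g -> linear f' -> linear g' ->
  cancel f f' -> cancel g g' -> cancel (tens_map f g) (tens_map f' g').
Proof.
move=> fl gl f'l g'l fK gK.
have fgP := tens_map_bilinear fl gl; have fgP' := tens_map_bilinear f'l g'l.
apply: (@tens_ext _ _ _ _ (tens_map f' g' \o tens_map f g) id) => [a x y|//|v w] /=.
  by rewrite /tens_map tlift_linear // (tlift_linear fgP').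
by rewrite /tens_map tlift_tens // tlift_tens // fK gK.
Qed.

Definition tens_aut (k : fieldType) (V W : lmodType k)
  (f : linAut V) (g : linAut W) : linAut (V ⊗ W) :=
  @LinAut k (V ⊗ W) (tens_map f g) (tens_map (aut_inv f) (aut_inv g))
    (tlift_linear (tens_map_bilinear (aut_linear f) (aut_linear g)))
    (tens_mapK (aut_linear f) (aut_linear g)
       (@aut_inv_linear k V f) (@aut_inv_linear k W g)
       (aut_funK f) (aut_funK g))
    (tens_mapK (@aut_inv_linear k V f) (@aut_inv_linear k W g)
       (aut_linear f) (aut_linear g) (aut_invK f) (aut_invK g)).

(* The structure maps of a monoidal Hom-bialgebra, without any axiom.  A       *)
(* linear map A ⊗ A -> A is given as a bilinear map A -> A -> A.               *)
Record homData (k : fieldType) (A : lmodType k) := HomData {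
  twist : linAut A;
  hmul : A -> A -> A;
  hone : A;
  hcomul : A -> A ⊗ A;
  hcounit : A -> k
}.
Arguments homData k A%_type.

Definition hom_algebra (k : fieldType) (A : lmodType k) (D : homData A) : Prop :=
  let alpha := twist D in
  let mul := hmul D in
  let one := hone D in
  [/\ is_bilinear mul,
      forall a b c, mul (alpha a) (mul b c) = mul (mul a b) (alpha c),
      forall a, mul a one = alpha a /\ mul one a = alpha a,
      forall a b, alpha (mul a b) = mul (alpha a) (alpha b)
    & alpha one = one].

(* Coassociativity lives in C ⊗ (C ⊗ C): the right-hand side is                *)
(* \sum c11 ⊗ (c12 ⊗ gamma^-1 c2).                                             *)
Definition hom_coalgebra (k : fieldType) (C : lmodType k) (D : homData C) : Prop :=
  let gamma := twist D in
  let gammaV := aut_inv (twist D) in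
  let Delta := hcomul D in
  let eps := hcounit D in
  [/\ linear Delta /\ scalar eps,
      forall c, \sw_(c1 ⊗ c2 <- Delta c) (gammaV c1 ⊗ Delta c2)
        = \sw_(c1 ⊗ c2 <- Delta c) \sw_(c11 ⊗ c12 <- Delta c1)
            (c11 ⊗ (c12 ⊗ gammaV c2)),
      forall c, \sw_(c1 ⊗ c2 <- Delta c) (eps c2 *: c1) = gammaV c
             /\ \sw_(c1 ⊗ c2 <- Delta c) (eps c1 *: c2) = gammaV c,
      forall c, Delta (gamma c)
        = \sw_(c1 ⊗ c2 <- Delta c) (gamma c1 ⊗ gamma c2)
    & forall c, eps (gamma c) = eps c].

Definition tens_mul (k : fieldType) (A B : lmodType k)
    (mulA : A -> A -> A) (mulB : B -> B -> B) (x y : A ⊗ B) : A ⊗ B :=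
  \sw_(x1 ⊗ x2 <- x) \sw_(y1 ⊗ y2 <- y) (mulA x1 y1 ⊗ mulB x2 y2).

Definition hom_bialgebra (k : fieldType) (H : lmodType k) (D : homData H) : Prop :=
  let mul := hmul D in
  let one := hone D in
  let Delta := hcomul D in
  let eps := hcounit D in
  [/\ hom_algebra D,
      hom_coalgebra D,
      forall g h, Delta (mul g h) = tens_mul mul mul (Delta g) (Delta h),
      Delta one = one ⊗ one
    & (forall g h, eps (mul g h) = eps g * eps h) /\ eps one = 1].

Definition hom_antipode (k : fieldType) (H : lmodType k) (D : homData H)
    (S : H -> H) : Prop :=
  let alpha := twist D in
  let mul := hmul D in
  let one := hone D in
  let Delta := hcomul D in
  let eps := hcounit D in
  [/\ linear S,
      forall h, S (alpha h) = alpha (S h),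
      forall h, \sw_(h1 ⊗ h2 <- Delta h) mul (S h1) h2 = eps h *: one
    & forall h, \sw_(h1 ⊗ h2 <- Delta h) mul h1 (S h2) = eps h *: one].

Definition hom_hopf (k : fieldType) (H : lmodType k) (D : homData H)
    (S : H -> H) : Prop :=
  hom_bialgebra D /\ hom_antipode D S.

Definition hom_module (k : fieldType) (H M : lmodType k) (D : homData H)
    (mu : linAut M) (act : H -> M -> M) : Prop :=
  let alpha := twist D in
  [/\ is_bilinear act,
      forall h g m, act (alpha h) (act g m) = act (hmul D h g) (mu m),
      forall m, act (hone D) m = mu m
    & forall h m, mu (act h m) = act (alpha h) (mu m)].

Definition hom_module_algebra (k : fieldType) (H B : lmodType k)
    (DH : homData H) (DB : homData B) (act : H -> B -> B) : Prop :=
  [/\ hom_algebra DB,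
      hom_module DH (twist DB) act,
      forall h a b, act h (hmul DB a b)
        = \sw_(h1 ⊗ h2 <- hcomul DH h) hmul DB (act h1 a) (act h2 b)
    & forall h, act h (hone DB) = hcounit DH h *: hone DB].

(* Coassociativity lives in M ⊗ (C ⊗ C).                                       *)
Definition hom_comodule (k : fieldType) (C M : lmodType k) (D : homData C)
    (mu : linAut M) (rho : M -> M ⊗ C) : Prop :=
  let gamma := twist D in
  let gammaV := aut_inv (twist D) in
  let muV := aut_inv mu in
  [/\ linear rho,
      forall m, \sw_(m0 ⊗ m1 <- rho m) (muV m0 ⊗ hcomul D m1)
        = \sw_(m0 ⊗ m1 <- rho m) \sw_(m00 ⊗ m01 <- rho m0)
            (m00 ⊗ (m01 ⊗ gammaV m1)),
      forall m, \sw_(m0 ⊗ m1 <- rho m) (hcounit D m1 *: m0) = muV m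
    & forall m, rho (mu m) = \sw_(m0 ⊗ m1 <- rho m) (mu m0 ⊗ gamma m1)].

Definition hom_comodule_coalgebra (k : fieldType) (B C : lmodType k)
    (DB : homData B) (DC : homData C) (rho : C -> C ⊗ B) : Prop :=
  [/\ hom_coalgebra DC,
      hom_comodule DB (twist DC) rho,
      forall c, \sw_(c0 ⊗ c1 <- rho c) \sw_(c01 ⊗ c02 <- hcomul DC c0)
          (c01 ⊗ c02 ⊗ c1)
        = \sw_(c1 ⊗ c2 <- hcomul DC c) \sw_(c10 ⊗ c11 <- rho c1)
            \sw_(c20 ⊗ c21 <- rho c2) (c10 ⊗ c20 ⊗ hmul DB c11 c21)
    & forall c, \sw_(c0 ⊗ c1 <- rho c) (hcounit DC c0 *: c1)
        = hcounit DC c *: hone DB].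

Definition smash_mul (k : fieldType) (B H : lmodType k)
    (DB : homData B) (DH : homData H) (act : H -> B -> B)
    (x y : B ⊗ H) : B ⊗ H :=
  let betaV := aut_inv (twist DB) in
  \sw_(a ⊗ h <- x) \sw_(b ⊗ g <- y) \sw_(h1 ⊗ h2 <- hcomul DH h)
    (hmul DB a (act h1 (betaV b)) ⊗ hmul DH (twist DH h2) g).

Definition smash_comul (k : fieldType) (B H : lmodType k)
    (DB : homData B) (DH : homData H) (rho : H -> H ⊗ B)
    (x : B ⊗ H) : (B ⊗ H) ⊗ (B ⊗ H) :=
  let betaV := aut_inv (twist DB) in
  \sw_(a ⊗ h <- x) \sw_(a1 ⊗ a2 <- hcomul DB a) \sw_(h1 ⊗ h2 <- hcomul DH h)
    \sw_(h10 ⊗ h11 <- rho h1)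
      ((a1 ⊗ twist DH h10) ⊗ (hmul DB (betaV a2) h11 ⊗ h2)).

Definition smash_counit (k : fieldType) (B H : lmodType k)
    (DB : homData B) (DH : homData H) (x : B ⊗ H) : k :=
  \sw_(a ⊗ h <- x) (hcounit DB a * hcounit DH h).

Definition smash (k : fieldType) (B H : lmodType k)
    (DB : homData B) (DH : homData H)
    (act : H -> B -> B) (rho : H -> H ⊗ B) : homData (B ⊗ H) :=
  {| twist := tens_aut (twist DB) (twist DH);
     hmul := smash_mul DB DH act;
     hone := hone DB ⊗ hone DH;
     hcomul := smash_comul DB DH rho;
     hcounit := smash_counit DB DH |}.

Definition smash_antipode (k : fieldType) (B H : lmodType k)
    (DB : homData B) (SB : B -> B) (DH : homData H) (SH : H -> H)
    (act : H -> B -> B) (rho : H -> H ⊗ B) (x : B ⊗ H) : B ⊗ H :=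
  let betaV := aut_inv (twist DB) in
  \sw_(a ⊗ h <- x) \sw_(h0 ⊗ h1 <- rho h)
    smash_mul DB DH act (hone DB ⊗ SH h0)
      (SB (hmul DB (betaV (betaV a)) (betaV h1)) ⊗ hone DH).

(* Main.v *)
(* In S * id, associativity of the smash product brings together the S_B-factor  *)
(* of S(a_1 # h_1(0)) and the B-part of the second leg; coassociativity of the   *)
(* coaction turns h_1(0)(1), h_1(1) into the two legs of Delta(h_1(1)), so that  *)
(* S_B * id collapses on the product a h_1(1), and what is left is S_H * id.     *)
(* In id * S, associativity brings together h_1(0) and S_H(h_2(0)); the comodule *)
(* coalgebra axiom turns them into the two legs of Delta(h_(0)), so that         *)
(* id * S_H collapses first and id * S_B is left.                                *)
Require Import Defs.
From HB Require Import structures.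
From mathcomp Require Import all_boot all_order all_algebra.

Set Implicit Arguments.
Unset Strict Implicit.
Unset Printing Implicit Defensive.

Import GRing.Theory.
Local Open Scope ring_scope.

(** Only the antipode axioms remain, and by linearity ([tens_ext]) they need checking on pure
    tensors [a ⊗ h] only. $S$ is a product of a factor from $H$ and a factor from $B$, so
    Hom-associativity of $B\#H$ lets the neighbouring factors from the same algebra be multiplied
    first, and [smash_mul_unitl], [smash_mul_unitr] show that such products involve no action. For
    $S*id$ ([smash_antipodel]), coassociativity of the coaction turns the inner product into
    $S_B*id$ at $\beta^{-2}(a)h_{1(1)}$, a scalar by [antipodel_mul]; the comodule counit then
    leaves $S_H*id$ at $h$. For $id*S$ ([smash_antipoder]), the comodule coalgebra axiom produces
    $id*S_H$ at $h_{(0)}$; the rule $\sum\varepsilon(h_{(0)})h_{(1)}=\varepsilon(h)1$ then leaves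
    $id*S_B$ at $a$. *)

(** * Multilinear calculus for Sweedler sums *)

Lemma linear_comp (k : fieldType) (U V W : lmodType k) (f : V -> W)
    (g : U -> V) : linear f -> linear g -> linear (fun x => f (g x)).
Proof. by move=> fl gl a x y; rewrite gl fl. Qed.

Lemma linear_scalel (k : fieldType) (U V : lmodType k) (e : U -> k) (v : V) :
  scalar e -> linear (fun x => e x *: v).
Proof. by move=> el a x y; rewrite el scalerDl scalerA. Qed.

(** The sum runs over a fixed representative of [t], so linearity in the parameter is inherited
    termwise; [F x] itself may be any function. *)
Lemma linear_tlift_fun (k : fieldType) (U V W X : lmodType k)
    (F : U -> V -> W -> X) (t : V ⊗ W) :
  (forall v w, linear (fun x => F x v w)) -> linear (fun x => tlift (F x) t).
Proof.
move=> Fl a x y; rewrite /tlift scaler_sumr -big_split /=.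
by apply: eq_bigr => p _; rewrite Fl.
Qed.

Ltac linear_base :=
  first
  [ assumption
  | exact: aut_linear
  | exact: aut_inv_linear
  | exact: (tens_bilinear _ _).1
  | exact: (tens_bilinear _ _).2
  | multimatch goal with
    | fP : is_bilinear ?f |- GRing.linear_for _ (?f _) => exact: fP.2
    | fP : is_bilinear ?f |- GRing.linear_for _ (fun x => ?f _ x) => exact: fP.2
    | fP : is_bilinear ?f |- GRing.linear_for _ (fun x => ?f x _) => exact: fP.1
    end ].

(* [match] must backtrack here: a pattern variable such as [?t] or [?c] may      *)
(* capture the bound [x], and the [apply] of that branch then fails.             *)
Ltac solve_linear :=
  first
  [ linear_base
  | exact: tens_bilinear
  | match goal with
    | |- is_bilinear _ => split; intro; cbn beta; solve_linear
    | |- GRing.linear_for _ (fun x => x) => intros ? ? ?; reflexivity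
    | |- GRing.linear_for _ (fun x => tlift (@?F x) ?t) =>
        apply: (@linear_tlift_fun _ _ _ _ _ F t); intros ? ?; cbn beta;
        solve_linear
    | |- GRing.linear_for _ (fun x => tlift ?F (@?t x)) =>
        apply: (@linear_comp _ _ _ _ (tlift F) t);
        [apply: tlift_linear; solve_linear | solve_linear]
    | |- GRing.linear_for _ (tlift _) => apply: tlift_linear; solve_linear
    | |- GRing.linear_for _ (fun x => ?e (@?g x) *: ?v) =>
        apply: (@linear_comp _ _ _ _ (fun y => e y *: v) g);
        [apply: linear_scalel; assumption | solve_linear]
    | |- GRing.linear_for _ (fun x => ?f (@?g x) ?c) =>
        apply: (@linear_comp _ _ _ _ (fun y => f y c) g);
        [linear_base | solve_linear]
    | |- GRing.linear_for _ (fun x => ?f (@?g x)) =>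
        apply: (@linear_comp _ _ _ _ f g); [linear_base | solve_linear]
    end ].

Lemma eq_tlift (k : fieldType) (V W : lmodType k) (U : zmodType)
    (f g : V -> W -> U) (t : V ⊗ W) :
  (forall v w, f v w = g v w) -> tlift f t = tlift g t.
Proof. by move=> fg; apply: eq_bigr => p _; exact: fg. Qed.

Lemma linear0E (k : fieldType) (V W : lmodType k) (f : V -> W) :
  linear f -> f 0 = 0.
Proof. by move=> fl; have := fl (-1) 0 0; rewrite scaler0 addr0 scaleN1r addNr. Qed.

Lemma linearZE (k : fieldType) (V W : lmodType k) (f : V -> W) a x :
  linear f -> f (a *: x) = a *: f x.
Proof. by move=> fl; have := fl a x 0; rewrite (linear0E fl) !addr0. Qed.

Lemma linear_tliftE (k : fieldType) (V W X Y : lmodType k) (g : X -> Y)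
    (f : V -> W -> X) (t : V ⊗ W) :
  linear g -> g (tlift f t) = \sw_(v ⊗ w <- t) g (f v w).
Proof.
move=> gl; rewrite /tlift; elim: (tens_repr t) => [|p s IHs].
  by rewrite !big_nil linear0E.
by rewrite !big_cons -IHs; have := gl 1 (f p.1 p.2); rewrite !scale1r => ->.
Qed.

(** Flattens nested Sweedler sums. Bilinearity of [F] matters: the representative of the inner sum
    is unrelated to those of its terms [G v w]. *)
Lemma tlift_tlift (k : fieldType) (V W X Y U : lmodType k) (F : X -> Y -> U)
    (G : V -> W -> X ⊗ Y) (t : V ⊗ W) :
  is_bilinear F ->
  tlift F (tlift G t) = \sw_(v ⊗ w <- t) tlift F (G v w).
Proof. by move=> FP; rewrite linear_tliftE //; exact: tlift_linear. Qed.

Lemma exchange_tlift (k : fieldType) (V W X Y : lmodType k) (U : zmodType)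
    (F : V -> W -> X -> Y -> U) (s : V ⊗ W) (t : X ⊗ Y) :
  \sw_(v ⊗ w <- s) \sw_(x ⊗ y <- t) F v w x y
    = \sw_(x ⊗ y <- t) \sw_(v ⊗ w <- s) F v w x y.
Proof. exact: exchange_big. Qed.

Lemma tliftZ (k : fieldType) (V W U : lmodType k) (f : V -> W -> U) (a : k)
    (t : V ⊗ W) : \sw_(v ⊗ w <- t) (a *: f v w) = a *: tlift f t.
Proof. by rewrite /tlift scaler_sumr. Qed.

Lemma tens_scalel (k : fieldType) (V W : lmodType k) (a : k) (v : V) (w : W) :
  (a *: v) ⊗ w = a *: (v ⊗ w).
Proof. by apply: (linearZE (f := fun x => x ⊗ w)); solve_linear. Qed.

Lemma tens_scaler (k : fieldType) (V W : lmodType k) (a : k) (v : V) (w : W) :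
  v ⊗ (a *: w) = a *: (v ⊗ w).
Proof. by apply: (linearZE (f := fun x => v ⊗ x)); solve_linear. Qed.

Lemma tens_autE (k : fieldType) (V W : lmodType k) (f : linAut V)
    (g : linAut W) v w : tens_aut f g (v ⊗ w) = f v ⊗ g w.
Proof. by rewrite /= /tens_map tlift_tens //; solve_linear. Qed.

Lemma tens_aut_invE (k : fieldType) (V W : lmodType k) (f : linAut V)
    (g : linAut W) v w :
  aut_inv (tens_aut f g) (v ⊗ w) = aut_inv f v ⊗ aut_inv g w.
Proof. by rewrite /= /tens_map tlift_tens //; solve_linear. Qed.

Lemma aut_fixV (k : fieldType) (V : lmodType k) (f : linAut V) x :
  f x = x -> aut_inv f x = x.
Proof. by move=> fx; rewrite -{1}fx aut_funK. Qed.

(** * Hom-structure axioms as identities between Sweedler sums *)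

(** A trilinear [F] induces a linear map on [M ⊗ (C ⊗ C)]; applying it to the axiom, an equality of
    tensors, lets coassociativity be used under any trilinear expression. *)
Lemma hom_comodule_coassoc (k : fieldType) (C M U : lmodType k)
    (D : homData C) (mu : linAut M) (rho : M -> M ⊗ C) (F : M -> C -> C -> U) m :
  hom_comodule D mu rho ->
  (forall x, is_bilinear (F x)) -> (forall c d, linear (fun x => F x c d)) ->
  \sw_(m0 ⊗ m1 <- rho m) \sw_(c1 ⊗ c2 <- hcomul D m1) F (aut_inv mu m0) c1 c2
    = \sw_(m0 ⊗ m1 <- rho m) \sw_(m00 ⊗ m01 <- rho m0)
        F m00 m01 (aut_inv (twist D) m1).
Proof.
move=> [_ /(_ m) coassoc _ _] FP Fl.
have FP' : is_bilinear (fun x => tlift (F x)).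
  by split=> [t|x]; [exact: linear_tlift_fun|exact: tlift_linear].
have /= := congr1 (tlift (fun x => tlift (F x))) coassoc.
rewrite !tlift_tlift // => E; transitivity (\sw_(m0 ⊗ m1 <- rho m)
  tlift (fun x => tlift (F x)) (aut_inv mu m0 ⊗ hcomul D m1)).
  by apply: eq_tlift => m0 m1; rewrite tlift_tens.
rewrite E; apply: eq_tlift => m0 m1; rewrite tlift_tlift //.
by apply: eq_tlift => m00 m01; rewrite !tlift_tens.
Qed.

Lemma hom_comodule_coalgebra_comul (k : fieldType) (B C U : lmodType k)
    (DB : homData B) (DC : homData C) (rho : C -> C ⊗ B)
    (F : C -> C -> B -> U) c :
  hom_comodule_coalgebra DB DC rho ->
  (forall b, is_bilinear (fun x y => F x y b)) ->
  (forall x y, linear (F x y)) ->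
  \sw_(c0 ⊗ c1 <- rho c) \sw_(c01 ⊗ c02 <- hcomul DC c0) F c01 c02 c1
    = \sw_(c1 ⊗ c2 <- hcomul DC c) \sw_(c10 ⊗ c11 <- rho c1)
        \sw_(c20 ⊗ c21 <- rho c2) F c10 c20 (hmul DB c11 c21).
Proof.
move=> [_ _ /(_ c) comulE _] FP Fl.
have FP' : is_bilinear (fun t b => tlift (fun x y => F x y b) t).
  by split=> [b|t]; [exact: tlift_linear|exact: linear_tlift_fun].
have /= := congr1 (tlift (fun t b => tlift (fun x y => F x y b) t)) comulE.
rewrite !tlift_tlift // => E; transitivity (\sw_(c0 ⊗ c1 <- rho c)
  tlift (fun t b => tlift (fun x y => F x y b) t)
    (\sw_(c01 ⊗ c02 <- hcomul DC c0) (c01 ⊗ c02 ⊗ c1))).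
  apply: eq_tlift => c0 c1; rewrite tlift_tlift //.
  by apply: eq_tlift => c01 c02; rewrite !tlift_tens.
rewrite E; apply: eq_tlift => c1 c2; rewrite tlift_tlift //.
apply: eq_tlift => c10 c11; rewrite tlift_tlift //.
by apply: eq_tlift => c20 c21; rewrite !tlift_tens.
Qed.

Lemma aut_inv_mul (k : fieldType) (A : lmodType k) (D : homData A) a b :
  hom_algebra D ->
  aut_inv (twist D) (hmul D a b)
    = hmul D (aut_inv (twist D) a) (aut_inv (twist D) b).
Proof.
move=> [_ _ _ mulM _]; apply: (can_inj (aut_funK (twist D))).
by rewrite mulM !aut_invK.
Qed.

Lemma counit_aut_inv (k : fieldType) (C : lmodType k) (D : homData C) c :
  hom_coalgebra D -> hcounit D (aut_inv (twist D) c) = hcounit D c.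
Proof. by move=> [_ _ _ _ /(_ (aut_inv (twist D) c))]; rewrite aut_invK => ->. Qed.

Lemma comul_aut_inv (k : fieldType) (C : lmodType k) (D : homData C) c :
  hom_coalgebra D ->
  hcomul D (aut_inv (twist D) c)
    = tens_map (aut_inv (twist D)) (aut_inv (twist D)) (hcomul D c).
Proof.
move=> [_ _ _ comulM _]; rewrite -{2}[c](aut_invK (twist D)) comulM.
exact/esym/(aut_funK (tens_aut (twist D) (twist D))).
Qed.

(** * Smash product, convolution and smash coproduct on elements *)

Lemma smash_mul_tens (k : fieldType) (B H : lmodType k) (DB : homData B)
    (DH : homData H) (act : H -> B -> B) a h b g :
  hom_algebra DH -> hom_coalgebra DH -> hom_module_algebra DH DB act ->
  smash_mul DB DH act (a ⊗ h) (b ⊗ g)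
    = \sw_(h1 ⊗ h2 <- hcomul DH h)
        (hmul DB a (act h1 (aut_inv (twist DB) b)) ⊗ hmul DH (twist DH h2) g).
Proof.
move=> [mulH _ _ _ _] [[comulH _] _ _ _ _] [[mulB _ _ _ _] [actP _ _ _] _ _].
by rewrite /smash_mul !tlift_tens //; solve_linear.
Qed.

(** As $\Delta(1)=1\otimes1$ and $1$ acts as $\beta$, the action cancels the $\beta^{-1}$ of the
    smash product. *)
Lemma smash_mul_unitl (k : fieldType) (B H : lmodType k) (DB : homData B)
    (DH : homData H) (act : H -> B -> B) a b g :
  hom_bialgebra DH -> hom_module_algebra DH DB act ->
  smash_mul DB DH act (a ⊗ hone DH) (b ⊗ g) = hmul DB a b ⊗ twist DH g.
Proof.
move=> [algH coalgH _ comul1 _] actA; rewrite smash_mul_tens // comul1.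
case: algH actA => [mulH _ mul1 _ aut1] [[mulB _ _ _ _] [actP _ act1 _] _ _].
rewrite tlift_tens; last by solve_linear.
by rewrite act1 aut_invK aut1 (mul1 g).2.
Qed.

Lemma smash_mul_unitr (k : fieldType) (B H : lmodType k) (DB : homData B)
    (DH : homData H) (act : H -> B -> B) b h g :
  hom_bialgebra DH -> hom_module_algebra DH DB act ->
  smash_mul DB DH act (b ⊗ h) (hone DB ⊗ g) = twist DB b ⊗ hmul DH h g.
Proof.
move=> [algH coalgH _ _ _] actA; rewrite smash_mul_tens //.
case: algH coalgH actA => [mulH _ _ _ _] [[comulH counitH] _ counit1 _ _].
move=> [[mulB _ mul1 _ aut1] [actP _ _ _] _ act1].
(* $h_1\cdot1=\varepsilon(h_1)1$; the scalar is moved onto $h_2$, where the counit axiom yields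
   $\alpha^{-1}(h)$ and $\alpha$ cancels the inverse. *)
under eq_tlift => h1 h2.
  rewrite (aut_fixV aut1) act1 (linearZE _ _ (mulB.2 b)) (mul1 b).1 tens_scalel -tens_scaler.
  rewrite -(linearZE _ _ (mulH.1 g)) -(linearZE _ _ (aut_linear (twist DH))).
  over.
rewrite -(linear_tliftE (g := fun x => twist DB b ⊗ hmul DH (twist DH x) g)).
  by rewrite (counit1 h).2 aut_invK.
by solve_linear.
Qed.

Lemma tlift_comul_aut_inv (k : fieldType) (C U : lmodType k) (D : homData C)
    (F : C -> C -> U) c :
  hom_coalgebra D -> is_bilinear F ->
  tlift F (hcomul D (aut_inv (twist D) c))
    = \sw_(c1 ⊗ c2 <- hcomul D c)
        F (aut_inv (twist D) c1) (aut_inv (twist D) c2).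
Proof.
move=> coalgD FP; rewrite comul_aut_inv // tlift_tlift //.
by apply: eq_tlift => c1 c2; rewrite tlift_tens.
Qed.

(** The antipode identity at the product $ac$, expanded by multiplicativity of $\Delta$ and
    $\varepsilon$. *)
Lemma antipodel_mul (k : fieldType) (A : lmodType k) (D : homData A)
    (S : A -> A) a c :
  hom_hopf D S ->
  \sw_(a1 ⊗ a2 <- hcomul D a) \sw_(c1 ⊗ c2 <- hcomul D c)
      hmul D (S (hmul D a1 c1)) (hmul D a2 c2)
    = (hcounit D a * hcounit D c) *: hone D.
Proof.
move=> [[[mulP _ _ _ _] [[comulP _] _ _ _ _] comulM _ [counitM _]] [SP _ SE _]].
have /= := SE (hmul D a c); rewrite counitM comulM => <-.
rewrite /tens_mul tlift_tlift; last by solve_linear.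
apply: eq_tlift => a1 a2; rewrite tlift_tlift; last by solve_linear.
by apply: eq_tlift => c1 c2; rewrite tlift_tens //; solve_linear.
Qed.

Lemma tlift_smash_comul (k : fieldType) (B H U : lmodType k) (DB : homData B)
    (DH : homData H) (rho : H -> H ⊗ B) (F : B ⊗ H -> B ⊗ H -> U) a h :
  hom_algebra DB -> hom_coalgebra DB -> hom_coalgebra DH -> linear rho ->
  is_bilinear F ->
  tlift F (smash_comul DB DH rho (a ⊗ h))
    = \sw_(a1 ⊗ a2 <- hcomul DB a) \sw_(h1 ⊗ h2 <- hcomul DH h)
        \sw_(h10 ⊗ h11 <- rho h1)
          F (a1 ⊗ twist DH h10) (hmul DB (aut_inv (twist DB) a2) h11 ⊗ h2).
Proof.
move=> [mulB _ _ _ _] [[comulB _] _ _ _ _] [[comulH _] _ _ _ _] rhoP FP.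
rewrite /smash_comul tlift_tens; last by solve_linear.
rewrite tlift_tlift //; apply: eq_tlift => a1 a2; rewrite tlift_tlift //.
apply: eq_tlift => h1 h2; rewrite tlift_tlift //.
by apply: eq_tlift => h10 h11; rewrite tlift_tens.
Qed.

(** * The map $S$ and its compatibility with the twist *)

Lemma smash_antipode_tens (k : fieldType) (B H : lmodType k)
    (DB : homData B) (SB : B -> B) (DH : homData H) (SH : H -> H)
    (act : H -> B -> B) (rho : H -> H ⊗ B) a h :
  is_bilinear (hmul DB) -> linear SB -> linear SH -> linear rho ->
  is_bilinear (smash_mul DB DH act) ->
  smash_antipode DB SB DH SH act rho (a ⊗ h)
    = \sw_(h0 ⊗ h1 <- rho h)
        smash_mul DB DH act (hone DB ⊗ SH h0)
          (SB (hmul DB (aut_inv (twist DB) (aut_inv (twist DB) a))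
             (aut_inv (twist DB) h1)) ⊗ hone DH).
Proof. by move=> *; rewrite /smash_antipode tlift_tens //; solve_linear. Qed.

Lemma smash_antipode_linear (k : fieldType) (B H : lmodType k)
    (DB : homData B) (SB : B -> B) (DH : homData H) (SH : H -> H)
    (act : H -> B -> B) (rho : H -> H ⊗ B) :
  is_bilinear (hmul DB) -> linear SB -> linear SH -> linear rho ->
  is_bilinear (smash_mul DB DH act) ->
  linear (smash_antipode DB SB DH SH act rho).
Proof. by move=> *; rewrite /smash_antipode; solve_linear. Qed.

Lemma smash_antipode_twist (k : fieldType) (B H : lmodType k)
    (DB : homData B) (SB : B -> B) (DH : homData H) (SH : H -> H)
    (act : H -> B -> B) (rho : H -> H ⊗ B) x :
  hom_hopf DB SB -> hom_hopf DH SH -> hom_comodule_coalgebra DB DH rho ->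
  hom_algebra (smash DB DH act rho) ->
  smash_antipode DB SB DH SH act rho (tens_aut (twist DB) (twist DH) x)
    = tens_aut (twist DB) (twist DH) (smash_antipode DB SB DH SH act rho x).
Proof.
move=> [[algB _ _ _ _] [SBP SBT _ _]] [[algH _ _ _ _] [SHP SHT _ _]].
move=> [_ [rhoP _ _ rhoT] _ _] [smP _ _ smT _].
have mulBV := aut_inv_mul _ _ algB.
case: algB algH => [mulBP _ _ mulBT oneBT] [_ _ _ _ oneHT].
rewrite /= in smP.
have {}smT y z : tens_aut (twist DB) (twist DH) (smash_mul DB DH act y z)
  = smash_mul DB DH act (tens_aut (twist DB) (twist DH) y)
      (tens_aut (twist DB) (twist DH) z) by exact: smT.
have SP := smash_antipode_linear mulBP SBP SHP rhoP smP.
move: x; apply: tens_ext; [by apply: linear_comp; solve_linear..|move=> a h].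
rewrite tens_autE !smash_antipode_tens // rhoT tlift_tlift; last by solve_linear.
rewrite [RHS]linear_tliftE; last by solve_linear.
apply: eq_tlift => h0 h1; rewrite tlift_tens; last by solve_linear.
rewrite smT !tens_autE oneBT oneHT SHT -SBT; congr (smash_mul _ _ _ _ (SB _ ⊗ _)).
by rewrite mulBT !aut_funK !aut_invK.
Qed.

(** * The two convolution identities *)

Lemma smash_antipodel (k : fieldType) (B H : lmodType k)
    (DB : homData B) (SB : B -> B) (DH : homData H) (SH : H -> H)
    (act : H -> B -> B) (rho : H -> H ⊗ B) a h :
  hom_hopf DB SB -> hom_hopf DH SH -> hom_module_algebra DH DB act ->
  hom_comodule_coalgebra DB DH rho -> hom_algebra (smash DB DH act rho) ->
  \sw_(x ⊗ y <- smash_comul DB DH rho (a ⊗ h))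
      smash_mul DB DH act (smash_antipode DB SB DH SH act rho x) y
    = (hcounit DB a * hcounit DH h) *: (hone DB ⊗ hone DH).
Proof.
move=> hopfB hopfH actA comodC [smP smA _ _ _]; rewrite /= in smP.
have {}smA x y z : smash_mul DB DH act (tens_aut (twist DB) (twist DH) x)
    (smash_mul DB DH act y z)
  = smash_mul DB DH act (smash_mul DB DH act x y)
      (tens_aut (twist DB) (twist DH) z) by exact: smA.
have [[algB coalgB _ _ _] [SBP SBT _ _]] := hopfB.
have [bialgH [SHP SHT SHl _]] := hopfH; have [algH coalgH _ _ _] := bialgH.
have [_ rhoC _ _] := comodC; have [rhoP _ counitR rhoT] := rhoC.
have mulBP : is_bilinear (hmul DB) by case: algB.
have mulHP : is_bilinear (hmul DH) by case: algH.
have comulBP : linear (hcomul DB) by case: coalgB => [[]].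
have comulHP : linear (hcomul DH) by case: coalgH => [[]].
have counitBP : scalar (hcounit DB) by case: coalgB => [[]].
have oneBT : twist DB (hone DB) = hone DB by case: algB.
have SP := smash_antipode_linear mulBP SBP SHP rhoP smP.
rewrite tlift_smash_comul //; last by solve_linear.
(* [P] is the product in $B$ on which $S_B*id$ will collapse; [c] and [d] stand for the legs of
   $\Delta(h_{1(1)})$. *)
pose P a1 a2 c d := hmul DB
  (SB (hmul DB (aut_inv (twist DB) (aut_inv (twist DB) a1)) c))
  (hmul DB (aut_inv (twist DB) (aut_inv (twist DB) a2)) d).
pose F a1 a2 g x c d := smash_mul DB DH act
  (hone DB ⊗ SH (twist DH (twist DH x))) (P a1 a2 c d ⊗ g).
transitivity (\sw_(a1 ⊗ a2 <- hcomul DB a) \sw_(h1 ⊗ h2 <- hcomul DH h)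
  \sw_(m0 ⊗ m1 <- rho h1) \sw_(c1 ⊗ c2 <- hcomul DB m1)
    F a1 a2 h2 (aut_inv (twist DH) m0) c1 c2).
  apply: eq_tlift => a1 a2; apply: eq_tlift => h1 h2.
  rewrite (hom_comodule_coassoc _ rhoC);
    [|by move=> x; rewrite /F /P; solve_linear
     |by move=> c d; rewrite /F /P; solve_linear].
  apply: eq_tlift => h10 h11; rewrite smash_antipode_tens // rhoT.
  rewrite tlift_tlift; last by solve_linear.
  rewrite (linear_tliftE _ _ (smP.1 _)).
  apply: eq_tlift => h100 h101; rewrite tlift_tens; last by solve_linear.
  (* Hom-associativity needs a twisted last factor, so that factor is written as the twist of its
     inverse image. *)
  rewrite aut_funK -[_ ⊗ h2](aut_invK (tens_aut (twist DB) (twist DH))) -smA.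
  rewrite tens_autE oneBT -SHT; congr smash_mul.
  by rewrite tens_aut_invE smash_mul_unitl // aut_invK aut_inv_mul.
transitivity (\sw_(h1 ⊗ h2 <- hcomul DH h) \sw_(m0 ⊗ m1 <- rho h1)
  (hcounit DB a *: (hcounit DB m1 *: (hone DB ⊗ hmul DH (SH (twist DH m0)) h2)))).
  rewrite exchange_tlift; apply: eq_tlift => h1 h2.
  rewrite exchange_tlift; apply: eq_tlift => m0 m1.
  rewrite /F aut_invK; set X := _ ⊗ SH _.
  under eq_tlift => a1 a2.
    rewrite -(linear_tliftE (g := fun b => smash_mul DB DH act X (b ⊗ h2)));
      last by solve_linear.
    over.
  rewrite -(linear_tliftE (g := fun b => smash_mul DB DH act X (b ⊗ h2)));
    last by solve_linear.
  have -> : \sw_(a1 ⊗ a2 <- hcomul DB a) \sw_(c1 ⊗ c2 <- hcomul DB m1)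
      P a1 a2 c1 c2 = (hcounit DB a * hcounit DB m1) *: hone DB.
    (* [P] contains the legs of $\Delta(\beta^{-2}(a))$, so $\varepsilon(a)$ is rewritten as
       $\varepsilon(\beta^{-2}(a))$. *)
    rewrite -(counit_aut_inv a coalgB) -(counit_aut_inv (aut_inv _ a) coalgB).
    rewrite -(antipodel_mul _ _ hopfB).
    by rewrite !tlift_comul_aut_inv //; solve_linear.
  rewrite tens_scalel (linearZE _ _ (smP.2 _)) smash_mul_unitr // oneBT.
  by rewrite scalerA.
transitivity (\sw_(h1 ⊗ h2 <- hcomul DH h)
  (hcounit DB a *: (hone DB ⊗ hmul DH (SH h1) h2))).
  apply: eq_tlift => h1 h2; rewrite tliftZ; congr (_ *: _).
  under eq_tlift => m0 m1.
    rewrite -(linearZE (f := fun x => hone DB ⊗ hmul DH (SH (twist DH x)) h2));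
      last by solve_linear.
    over.
  rewrite -(linear_tliftE (g := fun x => hone DB ⊗ hmul DH (SH (twist DH x)) h2));
    last by solve_linear.
  by rewrite counitR aut_invK.
rewrite tliftZ -(linear_tliftE (g := tens (hone DB))); last by solve_linear.
by rewrite SHl tens_scaler scalerA.
Qed.

Lemma smash_antipoder (k : fieldType) (B H : lmodType k)
    (DB : homData B) (SB : B -> B) (DH : homData H) (SH : H -> H)
    (act : H -> B -> B) (rho : H -> H ⊗ B) a h :
  hom_hopf DB SB -> hom_hopf DH SH -> hom_module_algebra DH DB act ->
  hom_comodule_coalgebra DB DH rho -> hom_algebra (smash DB DH act rho) ->
  \sw_(x ⊗ y <- smash_comul DB DH rho (a ⊗ h))
      smash_mul DB DH act x (smash_antipode DB SB DH SH act rho y)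
    = (hcounit DB a * hcounit DH h) *: (hone DB ⊗ hone DH).
Proof.
move=> hopfB hopfH actA comodC [smP smA _ _ _]; rewrite /= in smP.
have {}smA x y z : smash_mul DB DH act (tens_aut (twist DB) (twist DH) x)
    (smash_mul DB DH act y z)
  = smash_mul DB DH act (smash_mul DB DH act x y)
      (tens_aut (twist DB) (twist DH) z) by exact: smA.
have [[algB coalgB _ _ _] [SBP SBT _ SBr]] := hopfB.
have [bialgH [SHP SHT _ SHr]] := hopfH; have [algH coalgH _ _ _] := bialgH.
have [_ rhoC _ counitR] := comodC; have [rhoP _ _ rhoT] := rhoC.
have [mulBP mulBA mulB1 mulBT oneBT] := algB.
have mulHP : is_bilinear (hmul DH) by case: algH.
have comulBP : linear (hcomul DB) by case: coalgB => [[]].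
have comulHP : linear (hcomul DH) by case: coalgH => [[]].
have counitHP : scalar (hcounit DH) by case: coalgH => [[]].
have oneHT : twist DH (hone DH) = hone DH by case: algH.
have SP := smash_antipode_linear mulBP SBP SHP rhoP smP.
rewrite tlift_smash_comul //; last by solve_linear.
(* [T] is what [F] becomes, up to a scalar, once $h_{(0)1}S_H(h_{(0)2})$ collapses to
   $\varepsilon(h_{(0)})1$; it is linear in [b], which allows that scalar to be absorbed there. *)
pose T a1 a2 b := smash_mul DB DH act (a1 ⊗ hone DH)
  (SB (aut_inv (twist DB) (hmul DB a2 b)) ⊗ hone DH).
pose F a1 a2 x y b := smash_mul DB DH act (a1 ⊗ hmul DH x (SH y))
  (SB (aut_inv (twist DB) (hmul DB a2 b)) ⊗ hone DH).
transitivity (\sw_(a1 ⊗ a2 <- hcomul DB a) \sw_(h0 ⊗ h1 <- rho h)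
  \sw_(h01 ⊗ h02 <- hcomul DH h0) F a1 a2 h01 h02 h1).
  apply: eq_tlift => a1 a2; rewrite (hom_comodule_coalgebra_comul _ comodC);
    [|by move=> b; rewrite /F; solve_linear
     |by move=> x y; rewrite /F; solve_linear].
  apply: eq_tlift => h1 h2; apply: eq_tlift => h10 h11.
  rewrite smash_antipode_tens // (linear_tliftE _ _ (smP.2 _)).
  apply: eq_tlift => h20 h21.
  rewrite -[a1 ⊗ _](aut_invK (tens_aut (twist DB) (twist DH))) smA.
  rewrite tens_aut_invE aut_funK smash_mul_unitr // aut_invK /F.
  congr smash_mul; rewrite tens_autE oneHT -SBT; congr (SB _ ⊗ _).
  (* Hom-associativity in $B$ gathers $h_{1(1)}$ and $h_{2(1)}$ into the product required by the
     comodule coalgebra axiom. *)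
  rewrite mulBT !aut_invK !aut_inv_mul //.
  by rewrite -{1}[h21](aut_invK (twist DB)) -mulBA aut_invK.
transitivity (\sw_(a1 ⊗ a2 <- hcomul DB a) (hcounit DH h *:
  (hmul DB a1 (SB a2) ⊗ hone DH))).
  apply: eq_tlift => a1 a2.
  transitivity (\sw_(h0 ⊗ h1 <- rho h) T a1 a2 (hcounit DH h0 *: h1)).
    apply: eq_tlift => h0 h1.
    rewrite -(linear_tliftE (g := fun x => smash_mul DB DH act (a1 ⊗ x)
      (SB (aut_inv (twist DB) (hmul DB a2 h1)) ⊗ hone DH)));
      last by solve_linear.
    rewrite SHr tens_scaler (linearZE _ _ (smP.1 _)).
    by rewrite /T -(linearZE (f := T a1 a2)) // /T; solve_linear.
  rewrite -(linear_tliftE (g := T a1 a2)); last by rewrite /T; solve_linear.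
  rewrite counitR (linearZE (f := T a1 a2)); last by rewrite /T; solve_linear.
  by rewrite /T (mulB1 a2).1 aut_funK smash_mul_unitl // oneHT.
rewrite tliftZ -(linear_tliftE (g := fun b => b ⊗ hone DH)); last by solve_linear.
by rewrite SBr tens_scalel scalerA mulrC.
Qed.

Theorem theorem2p3 (k : fieldType) (B H : lmodType k)
  (DB : homData B) (SB : B -> B) (DH : homData H) (SH : H -> H)
  (act : H -> B -> B) (rho : H -> H ⊗ B) :
  hom_hopf DB SB ->
  hom_hopf DH SH ->
  hom_module_algebra DH DB act ->
  hom_comodule_coalgebra DB DH rho ->
  hom_bialgebra (smash DB DH act rho) ->
  hom_hopf (smash DB DH act rho) (smash_antipode DB SB DH SH act rho).
Proof.
move=> hopfB hopfH actA comodC bialg; split=> //.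
have [smA [[comulP counitP] _ _ _ _] _ _ _] := bialg.
have smP : is_bilinear (smash_mul DB DH act) by case: smA.
have SP : linear (smash_antipode DB SB DH SH act rho).
  case: hopfB hopfH comodC => [[[? _ _ _ _] _ _ _ _] [? _ _ _]] [_ [? _ _ _]].
  by move=> [_ [? _ _ _] _ _]; exact: smash_antipode_linear.
have counitE a h : smash_counit DB DH (a ⊗ h) = hcounit DB a * hcounit DH h.
  have [[_ [[_ eB] _ _ _ _] _ _ _] _] := hopfB.
  have [[_ [[_ eH] _ _ _ _] _ _ _] _] := hopfH.
  (* The counit takes values in the field, viewed as the module [k^o] over itself so that the
     universal property applies. *)
  rewrite /smash_counit (@tlift_tens _ _ _ k^o) //.
  by split=> [w c x y|v c x y] /=; [rewrite eB mulrDl -mulrA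
    | rewrite eH mulrDr mulrCA].
rewrite /= in comulP counitP; split=> //= [x|x|x].
- exact: smash_antipode_twist.
- move: x; apply: tens_ext; [by solve_linear..|move=> a h].
  by rewrite counitE; exact: smash_antipodel.
- move: x; apply: tens_ext; [by solve_linear..|move=> a h].
  by rewrite counitE; exact: smash_antipoder.
Qed.
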